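(* $\min\{\mathfrak{b},\mathfrak{s}\}\leq\mathrm{cov}^*(\mathcal{NC})\leq\mathfrak{b}$.
   Context: For $A\subseteq\omega\times\omega$ and $n<\omega$, $A(n)=\{m:(n,m)\in A\}$. $\mathcal{NC}=\{A\subseteq\omega\times\omega:\ \text{for every } X\in[\omega]^\omega,\ \{A(n):n\in X\}\text{ is not centered}\}$, where a family of subsets of $\omega$ is centered if all its finite nonempty subfamilies have infinite intersection. For an ideal $\mathcal{I}$ on a countable set $X$, $\mathrm{cov}^*(\mathcal{I})$ is the least size of $\mathcal{F}\subseteq\mathcal{I}$ such that every infinite $B\subseteq X$ has infinite intersection with some $A\in\mathcal{F}$. $\mathfrak{b}$ and $\mathfrak{s}$ are the bounding and splitting numbers. *)

(* Defs.v *)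
From mathcomp Require Import all_boot.
From mathcomp Require Import boolp classical_sets functions cardinality filter.

Set Implicit Arguments.
Unset Strict Implicit.
Unset Printing Implicit Defensive.

Local Open Scope classical_set_scope.
Local Open Scope card_scope.

(* A cardinal is represented by a type of that size. Only the comparison [cle],
   which is invariant under bijections, is applied to cardinals. *)
Definition cle (k l : Type) : Prop := [set: k] #<= [set: l].

Definition cmin (k l : Type) : Type := if pselect (cle k l) then k else l.

Definition has_least_size (T : Type) (P : set (set T)) (A : set T) : Prop :=
  P A /\ forall B, P B -> A #<= B.

(* Cardinals are well-ordered: project a maximal family of pairwise disjoint
   choice functions for the members of P. *)
Lemma has_least_size_ex (T : Type) (P : set (set T)) :
  P !=set0 -> exists A, has_least_size P A.
Proof.
move=> P0; have [P00|nP0] := pselect (P set0).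
  by exists set0; split=> // B _; exact: card_ge0.
pose Q (F : set (set T -> T)) :=
  (forall f, F f -> forall A, P A -> A (f A)) /\
  (forall f g A, F f -> F g -> P A -> f A = g A -> f = g).
have [F [[Fch Finj] Fmax]] : exists F, Q F /\ forall G, F `<` G -> ~ Q G.
  apply: Zorn_bigcup => C CQ Ctot; split.
    by move=> f [F CF Ff]; exact: (CQ _ CF).1.
  move=> f g A [F CF Ff] [G CG Gg] PA fg.
  have [FG|GF] := Ctot _ _ CF CG.
    by apply: ((CQ _ CG).2 f g A) => //; exact: FG.
  by apply: ((CQ _ CF).2 f g A) => //; exact: GF.
suff [A PA AF] : exists2 A, P A & forall x, A x -> exists2 f, F f & f A = x.
  exists A; split=> // B PB.
  have AFA : A `<=` (fun f : set T -> T => f A) @` F by move=> x /AF.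
  apply: (card_le_trans (subset_card_le AFA)).
  apply: (card_le_trans (card_image_le _ _)).
  have /card_eqPle[_ FB] : (fun f : set T -> T => f B) @` F #= F.
    by apply: inj_card_eq => f g; rewrite !inE => Ff Fg; exact: Finj.
  apply: (card_le_trans FB); apply: subset_card_le => _ [f Ff <-].
  exact: (Fch _ Ff _ PB).
apply: contrapT => noA.
have [h hP] : exists h : set T -> T,
    forall A, P A -> A (h A) /\ forall f, F f -> f A <> h A.
  have [A0 PA0] := P0.
  have [x0 _] : A0 !=set0 by apply/set0P/eqP => A00; rewrite A00 in PA0.
  suff /choice[h] : forall A, exists x, P A -> A x /\ forall f, F f -> f A <> x.
    by exists h.
  move=> A; have [PA|] := pselect (P A); last by exists x0.
  apply: contrapT => nx; apply: noA; exists A => // x Ax.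
  apply: contrapT => nf; apply: nx; exists x => _; split=> // f Ff fx.
  by apply: nf; exists f.
have [A0 PA0] := P0.
have nFh : ~ F h by move=> /((hP _ PA0).2 h); apply.
apply: (Fmax (F `|` [set h])).
  split=> [f Ff|/(_ h) /=]; first by left.
  by move=> Fh; apply: nFh; apply: Fh; right.
split=> [f [Ff|->] A PA|f g A [Ff|->] [Fg|->] PA fg //]; first exact: (Fch _ Ff _ PA).
- exact: (hP _ PA).1.
- exact: (Finj _ _ A).
- by have := (hP _ PA).2 _ Ff fg.
- by have := (hP _ PA).2 _ Fg (esym fg).
Qed.

Definition least_size (T : Type) (P : set (set T)) : Type :=
  set_type (xget set0 (has_least_size P)).

Lemma least_sizeP (T : Type) (P : set (set T)) : P !=set0 ->
  exists2 A, has_least_size P A & least_size P = set_type A.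
Proof.
move=> /has_least_size_ex[A PA].
by exists (xget set0 (has_least_size P)) => //; apply: xgetPex; exists A.
Qed.

Definition le_star (f g : nat -> nat) : Prop := \forall n \near \oo, f n <= g n.

Definition unbounded_family (F : set (nat -> nat)) : Prop :=
  ~ exists g, forall f, F f -> le_star f g.

Lemma unbounded_family_ex : unbounded_family !=set0.
Proof.
exists setT => -[g /(_ (fun n => (g n).+1) I)] [N _ /(_ N (leqnn N))] /=.
by rewrite ltnn.
Qed.

Definition bounding_number : Type := least_size unbounded_family.

Definition splits (S X : set nat) : Prop :=
  infinite_set (X `&` S) /\ infinite_set (X `\` S).

Definition splitting_family (F : set (set nat)) : Prop :=
  forall X, infinite_set X -> exists2 S, F S & splits S X.

Lemma splitting_family_ex : splitting_family !=set0.
Proof.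
exists setT => X /infiniteP/pcard_leP[f].
have fX n : X (f n) by exact: funS.
have finj : injective f by move=> m n; apply: inj; rewrite inE.
have infP (A : set nat) (g : nat -> nat) :
    (forall n, A (g n)) -> injective g -> infinite_set A.
  move=> gA ginj; apply/infiniteP/pcard_leP/injfunPex.
  by exists g => // m n _ _; exact: ginj.
exists [set f n.*2 | n in setT] => //; split.
  apply: (infP _ (fun n => f n.*2)) => [n|m n /finj/double_inj //].
  by split=> //; exists n.
apply: (infP _ (fun n => f n.*2.+1)) => [n|m n /finj[]/double_inj //].
by split=> // -[m _ /finj /(congr1 odd)] /=; rewrite !odd_double.
Qed.

Definition splitting_number : Type := least_size splitting_family.

Definition cov_star_family (X : countType) (I : set (set X))
    (F : set (set X)) : Prop :=
  F `<=` I /\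
  forall B, infinite_set B -> exists2 A, F A & infinite_set (A `&` B).

Definition cov_star (X : countType) (I : set (set X)) : Type :=
  least_size (cov_star_family I).

Definition centered (G : set (set nat)) : Prop :=
  forall F : set (set nat), finite_set F -> F !=set0 -> F `<=` G ->
    infinite_set (\bigcap_(Y in F) Y).

Definition NC : set (set (nat * nat)) :=
  [set A | forall X : set nat, infinite_set X -> ~ centered (xsection A @` X)].

Lemma cov_star_family_NC_ex : cov_star_family NC !=set0.
Proof.
have emptyNC (A : set (nat * nat)) (n : nat) :
    (forall m, m <> n -> finite_set (xsection A m)) -> NC A.
  move=> Afin X Xinf cX.
  have [m Xm mn] : exists2 m, X m & m <> n.
    apply: contrapT => nm; apply: Xinf; apply: (sub_finite_set _ (finite_set1 n)).
    by move=> m Xm; apply: contrapT => mn; apply: nm; exists m.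
  apply: (cX [set xsection A m]); first exact: finite_set1.
  - by exists (xsection A m).
  - by move=> _ ->; exists m.
  - by rewrite bigcap_set1; exact: Afin.
exists NC; split=> // B Binf.
have [Bfin|] := pselect (forall n, finite_set (xsection B n)).
  by exists B; rewrite ?setIid//; apply: (emptyNC _ 0) => m _; exact: Bfin.
move=> /existsNP[n Bn]; exists [set x | x.1 = n].
  apply: (emptyNC _ n) => m mn.
  apply: (sub_finite_set _ (@finite_set0 nat)) => k.
  by rewrite /xsection/= inE.
move=> fin; apply: Bn.
apply: (sub_finite_set _ (finite_image snd fin)) => k.
by rewrite /xsection/= inE => Bnk; exists (n, k).
Qed.

(* Main.v *)
Require Import Defs.
From mathcomp Require Import all_boot.
From mathcomp Require Import boolp classical_sets functions cardinality filter.

(** Upper bound: from an unbounded family F form, for f in F, the set of points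
    below the monotone envelope of f, together with finitely many full columns.
    These sets are in NC. If B has an infinite column, it is covered as soon as
    the numbers of full columns are unbounded over F; otherwise B has points
    (n, m) with n arbitrarily large, and if all the sets met B in a finite set,
    these points would give a function dominating F.

    Lower bound: let F be contained in NC. If the sections of members of F do
    not form a splitting family, fix an infinite Y that none of them splits. For
    A in F, the sections almost containing Y form a centered family, so there
    are finitely many of them, and almost every A(n) meets Y below some f_A(n).
    If some g dominated all the f_A, then choosing y_n in Y above g(n) would
    give an infinite set {(n, y_n)} almost disjoint from every A in F. Hence the
    sections form a splitting family, of size at most that of F * nat, that is
    of F, or the f_A form an unbounded family. *)


Set Implicit Arguments.
Unset Strict Implicit.
Unset Printing Implicit Defensive.

Local Open Scope classical_set_scope.
Local Open Scope card_scope.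

(** * Cardinality *)

Lemma infinite_set_seq (T : Type) (A : set T) : infinite_set A ->
  exists2 e : nat -> T, (forall n, A (e n)) & injective e.
Proof.
move=> /infiniteP/card_leP[f].
pose u n : [set: nat] := SigSub (in_setT n).
exists (fun n => \val (f (u n))) => [n|m n /val_inj fmn].
  by have /set_mem := valP (f (u n)).
have /(congr1 \val) // : u m = u n by apply: (@inj _ _ _ f) => //; rewrite inE.
Qed.

Lemma countable_cover_seq (T : Type) (x0 : T) (A : set T) : countable A ->
  exists u : nat -> T, forall x, A x -> exists n, u n = x.
Proof.
move=> /pcard_injP[f finj].
have /choice[u uP] : forall n, exists x, forall y, A y -> f y = n -> x = y.
  move=> n; have [[x [Ax fx]]|nx] := pselect (exists x, A x /\ f x = n).
    by exists x => y Ay fy; apply: finj; rewrite ?inE// fx fy.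
  by exists x0 => y Ay fy; case: nx; exists y.
by exists u => x Ax; exists (f x); exact: uP.
Qed.

(* A maximal partial function G whose domain D satisfies D `*` setT `<=` G @` D
   omits only finitely many points of F: a sequence of omitted points could be
   added to it through a bijection between nat * nat and nat. *)
Lemma infinite_card_setX_nat (T : Type) (F : set T) : infinite_set F ->
  F `*` [set: nat] #<= F.
Proof.
move=> Finf.
pose P (G : set (T * (T * nat))) :=
  [/\ forall x y z, G (x, y) -> G (x, z) -> y = z,
      forall x y, G (x, y) -> F x &
      forall x y, G (x, y) -> forall n, exists w, G (w, (x, n))].
have [G [[Gfun GF Gsurj] Gmax]] : exists G, P G /\ forall H, G `<` H -> ~ P H.
  apply: Zorn_bigcup => C CP Ctot; split.
  - move=> x y z [G CG Gxy] [H CH Hxz].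
    have [GH|HG] := Ctot _ _ CG CH.
      by have [+ _ _] := CP _ CH; apply; [exact: GH Gxy|exact: Hxz].
    by have [+ _ _] := CP _ CG; apply; [exact: Gxy|exact: HG Hxz].
  - by move=> x y [G CG Gxy]; have [_ + _] := CP _ CG; apply; exact: Gxy.
  - move=> x y [G CG Gxy] n; have [_ _ /(_ _ _ Gxy n)[w Gw]] := CP _ CG.
    by exists w, G.
pose L := [set x | F x /\ forall y, ~ G (x, y)].
have Lfin : finite_set L.
  apply: contrapT => /infinite_set_seq[e eL einj].
  pose E := [set p | exists i j : nat, p = (e (pickle (i, j)), (e i, j))].
  apply: (Gmax (G `|` E)).
    split=> [p Gp|GE]; first by left.
    apply: ((eL (pickle (0, 0))).2 (e 0, 0)).
    by apply: GE; right; exists 0, 0.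
  split.
  - move=> x y z [Gxy|[i [j [xe ->]]]] [Gxz|[i' [j' [xe' ->]]]].
    + exact: Gfun Gxy Gxz.
    + by case: ((eL (pickle (i', j'))).2 y); rewrite -xe'.
    + by case: ((eL (pickle (i, j))).2 z); rewrite -xe.
    + by move: xe'; rewrite xe => /einj/(pcan_inj pickleK)[-> ->].
  - by move=> x y [/GF//|[i [j [-> _]]]]; exact: (eL _).1.
  - move=> x y [Gxy n|[i [j [-> _]]] n].
      by have [w Gw] := Gsurj _ _ Gxy n; exists w; left.
    exists (e (pickle (pickle (i, j), n))); right.
    by exists (pickle (i, j)), n.
have [x0 [y0 Gx0]] : exists x y, G (x, y).
  apply: contrapT => nG; apply: Finf; apply: (sub_finite_set _ Lfin) => x Fx.
  by split=> // y Gxy; apply: nG; exists x, y.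
(* [G] already reaches the whole column over [x0]. Re-routing that column along an enumeration [u]
   of the columns over [x0] and [L] reaches the omitted ones without losing any. *)
have /(countable_cover_seq (x0, 0))[u uP] :
    countable ((x0 |` L) `*` [set: nat]).
  apply: countableX; last exact: countableP.
  by apply: finite_set_countable; rewrite finite_setU; split.
have /choice[h hP] : forall x, exists y, forall z, G (x, z) -> y = z.
  move=> x; have [[y Gxy]|nG] := pselect (exists y, G (x, y)).
    by exists y => z; exact: Gfun.
  by exists y0 => z Gxz; case: nG; exists z.
pose r (p : T * nat) := if pselect (p.1 = x0) then u p.2 else p.
apply: card_le_trans (card_image_le (r \o h) F).
apply: subset_card_le => -[x n] [/= Fx _].
have [xL|nxL] := pselect ((x0 |` L) x).
  have [k uk] := uP (x, n) (conj xL I).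
  have [w Gw] := Gsurj _ _ Gx0 k.
  exists w; first exact: GF Gw.
  by rewrite /= (hP _ _ Gw) /r /=; case: pselect.
have [y Gxy] : exists y, G (x, y).
  apply: contrapT => nG; apply: nxL; right; split=> // y Gxy.
  by apply: nG; exists y.
have [w Gw] := Gsurj _ _ Gxy n.
exists w; first exact: GF Gw.
rewrite /= (hP _ _ Gw) /r /=; case: pselect => // xx0.
by case: nxL; left.
Qed.

(** Of the two copies of [k] and [l] inside [k + l], one of least size embeds into the other. *)
Lemma cle_total (k l : Type) : cle k l \/ cle l k.
Proof.
pose P (A : set (k + l)) := A = range inl \/ A = range inr.
have [A [PA Amin]] : exists A, has_least_size P A.
  by apply: has_least_size_ex; exists (range inl); left.
have inlE : range (@inl k l) #= [set: k] by apply: inj_card_eq => x y _ _ [].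
have inrE : range (@inr k l) #= [set: l] by apply: inj_card_eq => x y _ _ [].
rewrite /cle -(card_le_eql inlE) -(card_le_eqr inrE).
rewrite -(card_le_eql inrE) -(card_le_eqr inlE).
by case: PA Amin => -> Amin; [left|right]; apply: Amin; [right|left].
Qed.

Lemma cle_trans (k l m : Type) : cle k l -> cle l m -> cle k m.
Proof. exact: card_le_trans. Qed.

Lemma cmin_cle (k l m : Type) : cle k m \/ cle l m -> cle (cmin k l) m.
Proof.
rewrite /cmin; case: pselect => [kl [//|/(cle_trans kl)//]|nkl [km|//]].
by have [//|lk] := cle_total k l; exact: cle_trans lk km.
Qed.

Lemma cle_set_type (T U : Type) (A : set T) (B : set U) :
  cle (set_type A) (set_type B) = (A #<= B).
Proof.
by rewrite /cle (card_le_eql (card_setT A)) (card_le_eqr (card_setT B)).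
Qed.

Lemma least_size_cle (T U : Type) (P : set (set T)) (A : set T) (B : set U) :
  P A -> A #<= B -> cle (least_size P) (set_type B).
Proof.
move=> PA AB; have [|C [PC Cmin] ->] := least_sizeP (P := P); first by exists A.
by rewrite cle_set_type; exact: card_le_trans (Cmin _ PA) AB.
Qed.

(** * Sets of natural numbers *)

Lemma finite_nat_bounded (A : set nat) : finite_set A ->
  exists N, forall n, A n -> n < N.
Proof.
move=> /finite_fsetP[X ->]; exists (\max_(i <- finmap.enum_fset X) i).+1 => n /= nX.
by rewrite ltnS; apply: (@leq_bigmax_seq _ _ xpredT id).
Qed.

Lemma bounded_finite_nat (A : set nat) (N : nat) :
  (forall n, A n -> n < N) -> finite_set A.
Proof. by move=> AN; apply: (sub_finite_set _ (finite_II N)) => n /AN. Qed.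

Lemma infinite_nat_ge (A : set nat) (N : nat) : infinite_set A ->
  exists2 n, A n & N <= n.
Proof.
move=> Ainf; apply: contrapT => nA; apply/Ainf/(@bounded_finite_nat _ N) => n An.
by rewrite ltnNge; apply/negP => Nn; apply: nA; exists n.
Qed.

Lemma infinite_section (A : set (nat * nat)) (n : nat) :
  infinite_set (xsection A n) -> infinite_set A.
Proof.
move=> + Afin; apply; apply: (sub_finite_set _ (finite_image snd Afin)) => m.
by rewrite /xsection /= inE => Anm; exists (n, m).
Qed.

Lemma infinite_finite_sections (B : set (nat * nat)) (N : nat) :
  infinite_set B -> (forall n, finite_set (xsection B n)) ->
  exists2 p, B p & N <= p.1.
Proof.
move=> Binf Bfin; apply: contrapT => nB; apply: Binf.
apply: (@sub_finite_set _ _ (\bigcup_(n in `I_N) [set (n, m) | m in xsection B n])).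
  move=> [n m] Bnm; exists n => /=.
    by rewrite ltnNge; apply/negP => Nn; apply: nB; exists (n, m).
  by exists m => //; rewrite /xsection /= inE.
apply: bigcup_finite => [|n _]; first exact: finite_II.
exact: finite_image.
Qed.

Lemma NC_finite_sections (A : set (nat * nat)) (N : nat) :
  (forall n, N <= n -> finite_set (xsection A n)) -> NC A.
Proof.
move=> Afin X Xinf cX; have [n Xn Nn] := infinite_nat_ge N Xinf.
apply: (cX [set xsection A n]); first exact: finite_set1.
- by exists (xsection A n).
- by move=> _ ->; exists n.
- by rewrite bigcap_set1; exact: Afin.
Qed.

(** * The upper bound *)

Lemma unbounded_family_infinite (F : set (nat -> nat)) :
  unbounded_family F -> infinite_set F.
Proof.
move=> Funb Ffin; apply: Funb.
have /choice[g gP] : forall n, exists N, forall f, F f -> f n < N.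
  move=> n; have [N NP] := finite_nat_bounded (finite_image (fun f => f n) Ffin).
  by exists N => f Ff; apply: NP; exists f.
by exists g => f Ff; exists 0 => // n _; exact/ltnW/gP.
Qed.

(** The monotone envelope of [f]: a point above it in any column from [k] on also bounds [f k]. *)
Definition running_max (f : nat -> nat) (n : nat) : nat := \max_(i < n.+1) f i.

Lemma leq_running_max (f : nat -> nat) (m n : nat) :
  m <= n -> f m <= running_max f n.
Proof.
by rewrite -ltnS => mn; exact: (leq_bigmax (Ordinal mn : 'I_n.+1)).
Qed.

Definition column_subgraph (N : nat) (f : nat -> nat) : set (nat * nat) :=
  [set p | p.1 <= N \/ p.2 <= running_max f p.1].

Lemma column_subgraph_NC (N : nat) (f : nat -> nat) : NC (column_subgraph N f).
Proof.
apply: (@NC_finite_sections _ N.+1) => n Nn.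
apply: (@bounded_finite_nat _ (running_max f n).+1) => m.
by rewrite /xsection /= inE => -[/=|//]; rewrite leqNgt Nn.
Qed.

Lemma cov_star_NC_le (F : set (nat -> nat)) : unbounded_family F ->
  exists2 C, cov_star_family NC C & C #<= F.
Proof.
move=> Funb.
have [e eF einj] := infinite_set_seq (unbounded_family_infinite Funb).
(* [c] inverts [e], with default 0 off its range, so that [A (e n)] contains the full column [n]. *)
have /choice[c cP] : forall f, exists n, forall m, e m = f -> m = n.
  move=> f; have [[n <-]|ne] := pselect (exists n, e n = f).
    by exists n => m /einj.
  by exists 0 => m em; case: ne; exists m.
pose A f := column_subgraph (c f) f.
exists (A @` F); last exact: card_image_le.
split=> [_ [f _ <-]|B Binf]; first exact: column_subgraph_NC.
have [Bfin|/existsNP[n Bn]] := pselect (forall n, finite_set (xsection B n)); last first.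
  exists (A (e n)); first by exists (e n).
  apply: (@infinite_section _ n); apply: sub_infinite_set Bn => m.
  rewrite /xsection /= !inE => Bnm; split=> //; left => /=.
  by rewrite -(cP (e n) n).
have /choice[p pP] : forall k, exists p, B p /\ k <= p.1.
  by move=> k; have [p] := infinite_finite_sections k Binf Bfin; exists p.
apply: contrapT => nA; apply: Funb; exists (fun k => (p k).2) => f Ff.
have ABfin : finite_set (A f `&` B).
  by apply: contrapT => ABinf; apply: nA; exists (A f) => //; exists f.
have [N NP] := finite_nat_bounded (finite_image fst ABfin).
exists N => // k /= Nk; have [Bp kp] := pP k.
apply: leq_trans (leq_running_max f kp) _.
(* Below the envelope, [p k] would lie in both [A f] and [B], hence in a column before [N], although
   its column is at least [k]. *)
rewrite leqNgt; apply/negP => pf.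
have : (p k).1 < N.
  by apply: NP; exists (p k) => //; split=> //; right; exact: ltnW.
by rewrite ltnNge (leq_trans Nk kp).
Qed.

(** * The lower bound *)

(* Relative to a nonprincipal ultrafilter, only finitely many sections of a
   member of NC are large, so that finitely many members of NC have small
   sections above a common index. *)
Lemma cov_star_family_NC_infinite (F : set (set (nat * nat))) :
  cov_star_family NC F -> infinite_set F.
Proof.
move=> [FNC Fcov] Ffin.
have [U [UU ooU]] := ultraFilterLemma eventually_filter.
have Uinf (Y : set nat) : U Y -> infinite_set Y.
  move=> UY /finite_nat_bounded[N YN].
  have UN : U [set n | N <= n] by apply: ooU; exists N.
  apply: (@filter_not_empty _ U); apply: filterS (filterI UY UN) => n [/YN].
  by rewrite ltnNge /= => /negP.
have Ucap (S : set (set nat)) : finite_set S -> S `<=` U ->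
    U (\bigcap_(Y in S) Y).
  move=> /finite_fsetP[X ->] XU.
  by apply: filter_bigI => Y YX; exact: XU.
have /choice[N NP] : forall A, exists N, F A ->
    forall n, U (xsection A n) -> n < N.
  move=> A; have [FA|] := pselect (F A); last by exists 0.
  suff /finite_nat_bounded[N NP] : finite_set [set n | U (xsection A n)].
    by exists N.
  apply: contrapT => /(FNC _ FA); apply => S Sfin _ SA; apply: Uinf.
  by apply: Ucap => // Y /SA[n Un <-].
(* In column [M] no section is in [U], so the complements of these sections have a common part in
   [U]: an infinite set that the family misses. *)
have [M MP] := finite_nat_bounded (finite_image N Ffin).
have UY : U (\bigcap_(Y in (fun A => ~` xsection A M) @` F) Y).
  apply: Ucap; first exact: finite_image.
  move=> _ [A FA <-]; have [UA|//] := in_ultra_setVsetC (xsection A M) UU.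
  have := NP A FA M UA; rewrite ltnNge => /negP; case.
  by apply: ltnW; apply: MP; exists A.
have [A FA] : exists2 A, F A & infinite_set (A `&`
    [set (M, m) | m in \bigcap_(Y in (fun A => ~` xsection A M) @` F) Y]).
  apply: Fcov => /(finite_image snd) fin; apply: (Uinf _ UY).
  apply: sub_finite_set fin => m Ym.
  by exists (M, m) => //; exists m.
apply; apply: (sub_finite_set _ (@finite_set0 _)) => _ [/[swap] [[m Ym <-]] AMm].
have /= := Ym (~` xsection A M); apply; first by exists A.
by rewrite /xsection /= inE.
Qed.

Definition section_family (F : set (set (nat * nat))) : set (set nat) :=
  [set xsection p.1 p.2 | p in F `*` [set: nat]].

(* An infinite Y that no section of A splits is almost contained in or almost
   disjoint from each section, and the sections of the first kind form a
   centered family. *)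
Lemma unsplit_NC_sections (A : set (nat * nat)) (Y : set nat) :
  NC A -> infinite_set Y -> (forall n, ~ splits (xsection A n) Y) ->
  exists N, forall n, N <= n -> finite_set (Y `&` xsection A n).
Proof.
move=> ANC Yinf nsplit.
have [N NP] : exists N, forall n, infinite_set (Y `&` xsection A n) -> n < N.
  apply: finite_nat_bounded.
  apply: contrapT => /ANC; apply => S Sfin _ SA capfin; apply: Yinf.
  (* [Y] lies in this union; each [Z] meets [Y] in an infinite set without splitting it, so [Y]
     minus [Z] is finite. *)
  have : finite_set (\bigcap_(Z in S) Z `|` \bigcup_(Z in S) (Y `\` Z)).
    rewrite finite_setU; split=> //.
    apply: bigcup_finite => // _ /SA[n nA <-].
    by apply: contrapT => YnA; apply: (nsplit n); split.
  apply: sub_finite_set => y Yy.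
  have [yS|/existsNP[Z /not_implyP[SZ nZy]]] := pselect (forall Z, S Z -> Z y).
    by left.
  by right; exists Z.
exists N => n Nn; apply: contrapT => /NP.
by rewrite ltnNge Nn.
Qed.

Lemma cov_star_NC_ge (F : set (set (nat * nat))) : cov_star_family NC F ->
  ~ splitting_family (section_family F) ->
  exists2 H, unbounded_family H & H #<= F.
Proof.
move=> [FNC Fcov] /existsNP[Y /not_implyP[Yinf nsplit]].
have /choice[f fP] : forall A, exists f : nat -> nat, F A ->
    exists N, forall n m, N <= n -> Y m -> A (n, m) -> m < f n.
  move=> A; have [FA|] := pselect (F A); last by exists id.
  have [|N NP] := unsplit_NC_sections (FNC _ FA) Yinf.
    by move=> n spl; apply: nsplit; exists (xsection A n) => //; exists (A, n).
  have /choice[f fP] : forall n, exists b, N <= n ->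
      forall m, Y m -> A (n, m) -> m < b.
    move=> n; have [/NP/finite_nat_bounded[b bP]|] := boolP (N <= n).
      by exists b => _ m Ym Anm; apply: bP; split=> //; rewrite /xsection /= inE.
    by exists 0.
  by exists f => _; exists N => n m Nn; exact: fP.
exists (f @` F); last exact: card_image_le.
move=> [g gP].
have /choice[y yP] : forall n, exists m, Y m /\ g n <= m.
  by move=> n; have [m] := infinite_nat_ge (g n) Yinf; exists m.
have [A FA] : exists2 A, F A & infinite_set (A `&` range (fun n => (n, y n))).
  apply: Fcov => /(finite_image fst) fin; apply: infinite_nat.
  by apply: sub_finite_set fin => n _; exists (n, y n) => //; exists n.
apply.
have [N NP] := fP A FA.
have [M _ MP] := gP (f A) (ex_intro2 _ _ A FA erefl).
apply: (@sub_finite_set _ _ ((fun n => (n, y n)) @` `I_(maxn N M))); last first.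
  by apply: finite_image; exact: finite_II.
move=> _ [/[swap] [[n _ <-]] Any]; exists n => //=.
(* Past both thresholds, [y n < f A n <= g n <= y n]. *)
rewrite ltnNge geq_max; apply/negP => /andP[Nn Mn].
have [Yy gy] := yP n.
have := leq_trans (NP _ _ Nn Yy Any) (leq_trans (MP n Mn) gy).
by rewrite ltnn.
Qed.

Theorem theorem4p6 :
  cle (cmin bounding_number splitting_number) (cov_star NC) /\
  cle (cov_star NC) bounding_number.
Proof.
split; last first.
  rewrite /bounding_number.
  have [F [Funb _] ->] := least_sizeP unbounded_family_ex.
  have [C CNC CF] := cov_star_NC_le Funb.
  exact: least_size_cle CNC CF.
rewrite /cov_star; have [F [FNC _] ->] := least_sizeP cov_star_family_NC_ex.
apply: cmin_cle.
have [spl|nspl] := pselect (splitting_family (section_family F)).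
  right; apply: least_size_cle spl _.
  apply: card_le_trans (card_image_le _ _) _.
  (* The factor [nat] is absorbed because a covering family is infinite. *)
  exact/infinite_card_setX_nat/(cov_star_family_NC_infinite FNC).
left; have [H Hunb HF] := cov_star_NC_ge FNC nspl.
exact: least_size_cle Hunb HF.
Qed.
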